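(* Let $\lambda$ be a Borel probability measure on $[0,1]$. Let $\mathcal P^1$ and $\mathcal P^2$ be two sequences of partitions that are log-balanced a.e. with respect to $\lambda$, with a.e. weight functions $f_1$ and $f_2$, respectively, such that all the following hold: (i) $\sum_{n=1}^\infty e^{-\delta f_1(n)}<\infty$ for every $\delta>0$; (ii) $f_2$ is nondecreasing; (iii) $f_2(n+1)-f_2(n)=o(f_2(n))$ as $n\to\infty$. Then $$\lim_{n\to\infty}\frac{f_2(L_n(x,\mathcal P^1,\mathcal P^2))}{f_1(n)}=1\quad\text{for }\lambda\text{-a.e. }x.$$
   Context: $\mathbb N$ includes $0$. A topological partition of $[0,1]$ is a collection of pairwise disjoint nonempty open intervals the union of whose closures is $[0,1]$. A sequence of partitions $\mathcal P=\{P_n\}_{n\in\mathbb N}$ is a sequence of topological partitions of $[0,1]$; $E=E^{\mathcal P}$ is the set of all endpoints of intervals in all the $P_n$; for $x\in[0,1]\setminus E$, $I_n(x)$ is the unique interval of $P_n$ containing $x$. $\mathcal P$ is log-balanced a.e. with respect to a Borel probability measure $\lambda$ on $[0,1]$ if $\lambda(E)=0$ and there is $f:\mathbb N\to\mathbb R$ with $f(n)\to+\infty$ such that $\lim_{n\to\infty}\frac{-\log\lambda(I_n(x))}{f(n)}=1$ for $\lambda$-a.e. $x$; any such $f$ is called an a.e. weight function of $\mathcal P$ with respect to $\lambda$. For sequences of partitions $\mathcal P^1,\mathcal P^2$ with endpoint sets $E^1,E^2$ and intervals $I_n^1(x),I_n^2(x)$, the Lochs index is $L_n(x,\mathcal P^1,\mathcal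 P^2)=\sup\{\ell\in\mathbb N : I_n^1(x)\subseteq I_\ell^2(x)\}$ (supremum in $\mathbb N\cup\{\infty\}$) for $x\in[0,1]\setminus(E^1\cup E^2)$. When both sequences are log-balanced with respect to $\lambda$, it is finite for $\lambda$-a.e. $x$, so $f_2(L_n(x,\mathcal P^1,\mathcal P^2))$ is defined for a.e. $x$. *)

(* Defs.v *)
From HB Require Import structures.
From mathcomp Require Import all_boot all_order all_algebra.
From mathcomp Require Import all_classical all_reals all_analysis.
Import Order.TTheory GRing.Theory Num.Theory.
Import numFieldNormedType.Exports.

Set Implicit Arguments.
Unset Strict Implicit.
Unset Printing Implicit Defensive.

Local Open Scope classical_set_scope.
Local Open Scope ring_scope.

Section LochsIndex.
Context {R : realType}.

(* The third condition forces all the intervals into [0, 1].  It is the union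
   of the closures, not the closure of the union, that equals [0, 1]. *)
Definition topological_partition (Q : set (set R)) : Prop :=
  [/\ forall I, Q I -> exists a b : R, a < b /\ I = `]a, b[%classic,
      trivIset Q id
    & \bigcup_(I in Q) closure I = `[0, 1]%classic].

Definition partition_sequence (P : nat -> set (set R)) : Prop :=
  forall n, topological_partition (P n).

Definition endpoints (P : nat -> set (set R)) : set R :=
  [set x | exists n, exists a b : R,
             [/\ a < b, P n `]a, b[%classic & x = a \/ x = b]].

(* I_n(x) is [cell (P n) x].  The default set0 is only used when no interval of
   Q contains x, i.e. when x is outside [0, 1] or is an endpoint of Q. *)
Definition cell (Q : set (set R)) (x : R) : set R :=
  xget set0 [set I | Q I /\ I x].

(* A Borel probability measure on [0, 1] is represented by a Borel probability
   measure on R giving mass 1 to [0, 1].  The quotient is taken in the extended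
   reals, so that - log 0 = +oo. *)
Definition ae_weight (lambda : probability (measurableTypeR R) R)
    (P : nat -> set (set R)) (f : nat -> R) : Prop :=
  f @ \oo --> +oo /\
  {ae lambda, forall x : R,
    (fun n => - lne (lambda (cell (P n) x)) / (f n)%:E)%E @ \oo --> 1%E}.

Definition log_balanced_ae (lambda : probability (measurableTypeR R) R)
    (P : nat -> set (set R)) : Prop :=
  lambda (endpoints P) = 0%E /\ exists f : nat -> R, ae_weight lambda P f.

(* The supremum is that of the complete chain nat U {+oo}, embedded in the
   extended reals; the max with 0 only matters for the empty set, whose
   supremum in this chain is 0 (ereal_sup would give -oo). *)
Definition lochs_index (P1 P2 : nat -> set (set R)) (n : nat) (x : R) : \bar R :=
  maxe 0%E (ereal_sup
    [set l%:R%:E | l in [set l : nat | cell (P1 n) x `<=` cell (P2 l) x]]).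

End LochsIndex.

(* Main.v *)
(* Borel-Cantelli argument of Dajani and Fieldsteel.  Fix e in ]0, 1[ and let
   m n be such that f2 (m n) <= (1 - e) f1 n < f2 (m n + 1).  A cell of
   P2 (m n) of typical size exp (- f2 (m n)) contains every cell of P1 n that
   meets it, except the at most two cells of P1 n around its endpoints, whose
   typical size exp (- f1 n) is smaller by a factor about exp (- e f1 n).  These
   factors being summable, almost every x satisfies
   cell (P1 n) x `<=` cell (P2 (m n)) x for n large, so that L_n x >= m n, and
   hypothesis (iii) turns this into the lower bound.  The upper bound is the
   monotonicity of lambda on cell (P1 n) x `<=` cell (P2 (L_n x)) x. *)
Require Import Defs.
From HB Require Import structures.
From mathcomp Require Import all_boot all_order all_algebra.
From mathcomp Require Import all_classical all_reals all_analysis.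
From mathcomp Require Import lra.
Import Order.TTheory GRing.Theory Num.Theory.
Import numFieldNormedType.Exports.

Local Open Scope classical_set_scope.
Local Open Scope ring_scope.

(** * Cells and endpoints of a topological partition *)

Lemma cell_mem (R : realType) (Q : set (set R)) (I : set R) (x : R) :
  topological_partition Q -> Q I -> I x -> cell Q x = I.
Proof.
move=> [_ tQ _] QI Ix; apply: xget_unique => // J [QJ Jx].
by apply: (tQ _ _ QJ QI); exists x.
Qed.

Lemma cellP (R : realType) (Q : set (set R)) (x : R) :
  cell Q x = set0 \/ Q (cell Q x) /\ cell Q x x.
Proof. by rewrite /cell; case: xgetP => [I _|_]; [right | left]. Qed.

Lemma measurable_cell (R : realType) (Q : set (set R)) (x : R) :
  topological_partition Q -> measurable (cell Q x : set (measurableTypeR R)).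
Proof.
move=> [iQ _ _]; have [->|[/iQ[a [b [_ ->]]] _]] := cellP _ Q x.
  exact: measurable0.
exact: measurable_itv.
Qed.

Lemma countable_topological_partition (R : realType) (Q : set (set R)) :
  topological_partition Q -> countable Q.
Proof.
move=> [iQ tQ _].
(* Sets outside [Q] are sent to the whole line, because the countability criterion asks every member
   of the family to be open and nonempty. *)
pose B (I : set R) := if `[< Q I >] then I else setT.
apply: (@separated_open_countable R _ B).
- move=> I; rewrite /B; case: asboolP => [/iQ[a [b [_ ->]]]|_].
    exact: interval_open.
  exact: openT.
- move=> I; rewrite /B; case: asboolP => [/iQ[a [b [ab ->]]]|_].
    by exists ((a + b) / 2); rewrite /= in_itv/= !midf_lt.
  by exists 0.
- move=> I J QI QJ; rewrite /B !asboolT//; exact: tQ.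
Qed.

(** Turns a partition into a sequence, so that countable additivity applies to its cells. Indices
    that code no cell receive an empty interval. *)
Lemma topological_partition_enum (R : realType) (Q : set (set R)) :
  topological_partition Q -> exists a b : nat -> R,
    [/\ trivIset setT (fun k => `]a k, b k[%classic),
        forall k, `]a k, b k[%classic = set0 \/ Q `]a k, b k[%classic &
        forall I, Q I -> exists k, I = `]a k, b k[%classic].
Proof.
move=> pQ; have /countable_injP[f finj] := countable_topological_partition _ _ pQ.
have [iQ tQ _] := pQ.
pose F k := xget set0 [set I | Q I /\ f I = k].
have FP k : F k = set0 \/ Q (F k) /\ f (F k) = k.
  by rewrite /F; case: xgetP => [I _|_]; [right | left].
have Fitv k : exists ab : R * R, F k = `]ab.1, ab.2[%classic.
  have [->|[/iQ[a [b [_ ->]]] _]] := FP k; last by exists (a, b).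
  by exists (0, 0); rewrite set_itvoo0.
have [ab abE] := choice Fitv.
exists (fst \o ab), (snd \o ab).
have -> : (fun k => `](fst \o ab) k, (snd \o ab) k[%classic) = F.
  by apply/funext => k; rewrite abE.
split.
- move=> i j _ _ [x [Fix_ Fjx]].
  have [Fi0|[QFi <-]] := FP i; first by rewrite Fi0 in Fix_.
  have [Fj0|[QFj <-]] := FP j; first by rewrite Fj0 in Fjx.
  by congr f; apply: (tQ _ _ QFi QFj); exists x.
- by move=> k /=; rewrite -abE; have [->|[]] := FP k; [left | right].
- move=> I QI; exists (f I) => /=; rewrite -abE /F.
  apply/esym; apply: xget_unique => // J [QJ fJI].
  by apply: finj; rewrite ?inE.
Qed.

(** Makes the endpoint set measurable. An open interval determines its endpoints, as infimum and
    supremum, so countably many cells have countably many endpoints. *)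
Lemma countable_endpoints (R : realType) (P : nat -> set (set R)) :
  partition_sequence P -> countable (endpoints P).
Proof.
move=> pP.
have E n : exists ab : (nat -> R) * (nat -> R),
    forall I, P n I -> exists k, I = `]ab.1 k, ab.2 k[%classic.
  by have [a [b [_ _ ?]]] := topological_partition_enum _ _ (pP n); exists (a, b).
have [ab abE] := choice E.
apply: (@sub_countable _ _ _ ([set: nat * nat] `*` [set: bool])); last first.
  exact: countableX.
apply: card_le_trans (card_image_le
  (fun p : nat * nat * bool => if p.2 then (ab p.1.1).1 p.1.2 else (ab p.1.1).2 p.1.2) _).
apply: subset_card_le => x [n [a [b [ltab Pn xab]]]].
have [k Ik] := abE _ _ Pn.
have ltk : (ab n).1 k < (ab n).2 k.
  have : `]a, b[%classic ((a + b) / 2) by rewrite /= in_itv/= !midf_lt.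
  by rewrite Ik /= in_itv/= => /andP[]; exact: lt_trans.
have [ak bk] : a = (ab n).1 k /\ b = (ab n).2 k.
  have := (congr1 inf Ik, congr1 sup Ik).
  by rewrite !inf_itv ?bnd_simp// !sup_itv ?bnd_simp// => -[].
case: xab => ->.
- by exists (n, k, true).
- by exists (n, k, false).
Qed.

Lemma cell_exists (R : realType) (P : nat -> set (set R)) (x : R) (n : nat) :
  partition_sequence P -> `[0, 1]%classic x -> ~ endpoints P x ->
  P n (cell (P n) x) /\ cell (P n) x x.
Proof.
move=> pP x01 nEx; have [iP _ cP] := pP n.
have [I PI clIx] : (\bigcup_(I in P n) closure I) x by rewrite cP.
have [a [b [ab Iab]]] := iP _ PI.
have Ix : I x.
  rewrite Iab in clIx *; have /= := itv_closure clIx.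
  rewrite !in_itv/= !le_eqVlt => /andP[/orP[/eqP ax|->] /orP[/eqP xb|->]] //;
    by exfalso; apply: nEx; exists n, a, b; rewrite -Iab; split; auto.
by rewrite (cell_mem _ _ I).
Qed.

Lemma itv_subset_no_endpoint (R : realType) (p q a b x : R) :
  `]p, q[%classic x -> `]a, b[%classic x ->
  ~ `]p, q[%classic a -> ~ `]p, q[%classic b ->
  `]p, q[ `<=` `]a, b[.
Proof.
rewrite /= !in_itv/= => /andP[px xq] /andP[ax xb] /negP + /negP.
rewrite !negb_and -!leNgt => apq bpq y; rewrite /= !in_itv/= => /andP[py yq].
have ap : a <= p by case/orP: apq => // /(lt_le_trans xq)/(lt_trans ax); rewrite ltxx.
have qb : q <= b.
  by case/orP: bpq => // bp; move: (lt_trans px xb); rewrite ltNge bp.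
by rewrite (le_lt_trans ap)//= (lt_le_trans yq).
Qed.

(** * Borel-Cantelli estimate for inclusions of cells *)

Section CellMeasure.
Context (R : realType) (lambda : probability (measurableTypeR R) R).

(* In a cell J of Q2 of mass at least beta, the points whose Q1-cell is not
   contained in J lie in the at most two cells of Q1 around the endpoints of J;
   this costs 2 alpha <= (2 alpha / beta) * lambda J, which sums to
   2 alpha / beta over the disjoint cells J. *)
Lemma cell_not_subset_measure (Q1 Q2 : set (set R)) (alpha beta : R) :
  topological_partition Q1 -> topological_partition Q2 ->
  0 <= alpha -> 0 < beta ->
  exists C : set (measurableTypeR R),
    [/\ measurable C, (lambda C <= (2 * alpha / beta)%:E)%E &
        forall x, Q1 (cell Q1 x) /\ cell Q1 x x -> Q2 (cell Q2 x) /\ cell Q2 x x ->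
          (lambda (cell Q1 x) <= alpha%:E)%E -> (beta%:E <= lambda (cell Q2 x))%E ->
          ~ C x -> cell Q1 x `<=` cell Q2 x].
Proof.
move=> pQ1 pQ2 alpha0 beta0.
have [a [b [tF _ FQ]]] := topological_partition_enum _ _ pQ2.
pose F k : set (measurableTypeR R) := `]a k, b k[%classic.
have mF k : measurable (F k) by exact: measurable_itv.
(* Cells heavier than [alpha] are dropped, which makes the bound [gle] uniform in [y]; only points
   with a light [Q1]-cell need to be covered. *)
pose g (y : R) : set (measurableTypeR R) :=
  if (lambda (cell Q1 y) <= alpha%:E)%E then cell Q1 y else set0.
have mg y : measurable (g y).
  by rewrite /g; case: ifPn => _; [exact: measurable_cell | exact: measurable0].
have gle y : (lambda (g y) <= alpha%:E)%E.
  by rewrite /g; case: ifPn => // _; rewrite measure0 lee_fin.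
pose G k : set (measurableTypeR R) :=
  if (beta%:E <= lambda (F k))%E then g (a k) `|` g (b k) else set0.
have mG k : measurable (G k).
  by rewrite /G; case: ifPn => _; [exact: measurableU | exact: measurable0].
have ab0 : 0 <= 2 * alpha / beta by rewrite divr_ge0 ?mulr_ge0// ltW.
have Gle k : (lambda (G k) <= (2 * alpha / beta)%:E * lambda (F k))%E.
  rewrite /G; case: ifPn => [betaF|_]; last by rewrite measure0 mule_ge0 ?lee_fin.
  apply: (@le_trans _ _ (alpha%:E + alpha%:E)%E).
    by apply: le_trans (leeD (gle _) (gle _)); exact: measureU2.
  apply: (@le_trans _ _ ((2 * alpha / beta)%:E * beta%:E)%E).
    by rewrite -EFinD -EFinM lee_fin divfK ?gt_eqF// mulrDl !mul1r.
  by apply: lee_wpmul2l => //; rewrite lee_fin.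
exists (\bigcup_k G k); split.
- exact: bigcup_measurable.
- apply: (@le_trans _ _ (\sum_(k <oo) lambda (G k))%E).
    by apply: measure_sigma_subadditive => //; exact: bigcup_measurable.
  apply: (@le_trans _ _ (\sum_(k <oo) ((2 * alpha / beta)%:E * lambda (F k)))%E).
    by apply: lee_nneseries => // k _; exact: Gle.
  rewrite nneseriesZl// -measure_semi_bigcup//; last exact: bigcup_measurable.
  rewrite -[leRHS]mule1; apply: lee_wpmul2l; first by rewrite lee_fin.
  by apply: probability_le1; exact: bigcup_measurable.
- move=> x [Q1x xx] [Q2x xx2] lea leb nCx.
  have [k Jk] := FQ _ Q2x.
  have [iQ1 _ _] := pQ1; have [p [q [_ Ipq]]] := iQ1 _ Q1x.
  (* The [Q1]-cell of [x] is also the cell of any endpoint [y] that it contains, so such a [y] would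
     put [x] in [G k]. *)
  have nend y : y = a k \/ y = b k -> ~ cell Q1 x y.
    move=> yab Iy; apply: nCx; exists k => //.
    rewrite /G /F -Jk leb.
    have gx : g y x by rewrite /g (cell_mem _ _ _ _ pQ1 Q1x Iy) lea.
    by case: yab => <-; [left | right].
  rewrite Jk Ipq; apply: (@itv_subset_no_endpoint _ _ _ _ _ x).
  + by rewrite -Ipq.
  + by rewrite -Jk.
  + by rewrite -Ipq; apply: nend; left.
  + by rewrite -Ipq; apply: nend; right.
Qed.

Lemma ae_cell_exists (P : nat -> set (set R)) :
  lambda `[0, 1]%classic = 1%E -> partition_sequence P ->
  lambda (endpoints P) = 0%E ->
  {ae lambda, forall x, forall n, P n (cell (P n) x) /\ cell (P n) x x}.
Proof.
move=> l01 pP lE.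
have mE : measurable (endpoints P : set (measurableTypeR R)).
  by apply: countable_measurable; [exact: measurable_set1 | exact: countable_endpoints].
have mI : measurable (`[0, 1]%classic : set (measurableTypeR R)).
  exact: measurable_itv.
exists (~` `[0, 1]%classic `|` endpoints P); split.
- by apply: measurableU => //; exact: measurableC.
- apply/eqP; rewrite -measure_le0.
  apply: le_trans (measureU2 _ (measurableC mI) mE) _.
  have l01C := probability_setC lambda mI; rewrite l01 subee// in l01C.
  by rewrite -[leRHS]adde0; apply: leeD; rewrite measure_le0; apply/eqP.
- move=> x; apply: contra_notP => /not_orP[/contrapT x01 nEx] n.
  exact: cell_exists.
Qed.

(** A partition has countably many cells, so its null cells together cover only a null set. *)
Lemma ae_cell_gt0 (P : nat -> set (set R)) :
  lambda `[0, 1]%classic = 1%E -> partition_sequence P ->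
  lambda (endpoints P) = 0%E ->
  {ae lambda, forall x, forall n, (0 < lambda (cell (P n) x))%E}.
Proof.
move=> l01 pP lE; apply: ae_foralln => n.
have ae_filter := @ae_filter_ringOfSetsType _ _ _ lambda.
have [a [b [_ _ FQ]]] := topological_partition_enum _ _ (pP n).
have N : lambda.-negligible (\bigcup_k
    (if lambda `]a k, b k[%classic == 0%E then `]a k, b k[%classic else set0)).
  apply: negligible_bigcup => k; case: ifPn => [/eqP l0|_].
    by apply/negligibleP => //; exact: measurable_itv.
  exact: negligible_set0.
have NN : {ae lambda, forall x, ~ (\bigcup_k
    (if lambda `]a k, b k[%classic == 0%E then `]a k, b k[%classic else set0)) x}.
  by apply: negligibleS N => x /contrapT.
have := ae_cell_exists _ l01 pP lE; apply: filterS2 NN => x nx /(_ n)[Px xx].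
rewrite lt0e measure_ge0 andbT; apply/negP => l0.
have [k Ik] := FQ _ Px.
by apply: nx; exists k => //; rewrite -Ik l0.
Qed.

(** Borel-Cantelli for the exceptional sets of [cell_not_subset_measure]. The size conditions stay
    under the quantifier on [n], since they will hold only from a rank depending on [x]. *)
Lemma ae_eventually_cell_subset (P1 P2 : nat -> set (set R)) (m : nat -> nat)
    (alpha beta : nat -> R) :
  lambda `[0, 1]%classic = 1%E ->
  partition_sequence P1 -> partition_sequence P2 ->
  lambda (endpoints P1) = 0%E -> lambda (endpoints P2) = 0%E ->
  (forall n, 0 <= alpha n) -> (forall n, 0 < beta n) ->
  (\sum_(n <oo) (2 * alpha n / beta n)%:E < +oo)%E ->
  {ae lambda, forall x, \forall n \near \oo,
    (lambda (cell (P1 n) x) <= (alpha n)%:E)%E ->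
    ((beta n)%:E <= lambda (cell (P2 (m n)) x))%E ->
    cell (P1 n) x `<=` cell (P2 (m n)) x}.
Proof.
move=> l01 pP1 pP2 lE1 lE2 alpha0 beta0 sumab.
have ae_filter := @ae_filter_ringOfSetsType _ _ _ lambda.
have [C CP] := choice (fun n =>
  cell_not_subset_measure _ _ _ _ (pP1 n) (pP2 (m n)) (alpha0 n) (beta0 n)).
have mC n : measurable (C n) by have [] := CP n.
have BC : lambda (lim_sup_set C) = 0%E.
  apply: lim_sup_set_cvg0 => //.
  apply: le_lt_trans sumab; apply: lee_nneseries => // n _.
  by have [] := CP n.
have aeC : {ae lambda, forall x, ~ lim_sup_set C x}.
  exists (lim_sup_set C); split => //.
  - by apply: bigcapT_measurable => n; exact: bigcup_measurable.
  - by move=> x /contrapT.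
have := ae_cell_exists _ l01 pP1 lE1; have := ae_cell_exists _ l01 pP2 lE2.
move: aeC; apply: filterS3 => x nCx ex2 ex1.
have [N _ NC] : \forall n \near \oo, ~ C n x.
  apply: contra_notP nCx => nC k _; apply: contrapT => nCk; apply: nC.
  by exists k => // j kj Cj; apply: nCk; exists j.
exists N => // n /NC nCn lea leb.
by have [_ _] := CP n; apply.
Qed.

End CellMeasure.

(** * Attained suprema, exponential size bounds and choice of scale *)

Lemma lochs_index_bounded (R : realType) (P1 P2 : nat -> set (set R)) (n : nat) (x : R) (B : nat) :
  (forall l, cell (P1 n) x `<=` cell (P2 l) x -> (l <= B)%N) ->
  exists L : nat, [/\ lochs_index P1 P2 n x = L%:R%:E,
    L = 0%N \/ cell (P1 n) x `<=` cell (P2 L) x &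
    forall l, cell (P1 n) x `<=` cell (P2 l) x -> (l <= L)%N].
Proof.
move=> leB.
pose S := [set l : nat | cell (P1 n) x `<=` cell (P2 l) x].
have [[l0 Sl0]|S0] := pselect (exists l, S l); last first.
  (* With no admissible [l], the [maxe] in [lochs_index] gives 0; the alternative [L = 0] accounts
     for this case. *)
  exists 0%N; split; [|by left|by move=> l Sl; exfalso; apply: S0; exists l].
  rewrite /lochs_index (_ : [set l | _] = set0).
    by rewrite image_set0 ereal_sup0 maxC max_r ?leNye.
  by apply/seteqP; split => // l Sl; apply: S0; exists l.
have exS : exists l, `[< S l >] by exists l0; apply/asboolP.
have bndS l : `[< S l >] -> (l <= B)%N by move=> /asboolP; exact: leB.
have [L /asboolP SL Lmax] := ex_maxnP exS bndS.
have {}Lmax l : S l -> (l <= L)%N by move=> Sl; apply: Lmax; exact/asboolP.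
exists L; split => //; last by right.
rewrite /lochs_index; have -> : ereal_sup [set l%:R%:E | l in S] = L%:R%:E :> \bar R.
  apply/eqP; rewrite eq_le; apply/andP; split.
    apply: ge_ereal_sup => _ [l /Lmax lL <-].
    by rewrite lee_fin ler_nat.
  by apply: ereal_sup_ubound; exists L.
by rewrite max_r// lee_fin.
Qed.

Lemma weight_expR_bounds (R : realType) (u : nat -> \bar R) (f : nat -> R) (eta : R) :
  f @ \oo --> +oo -> (fun n => - lne (u n) / (f n)%:E)%E @ \oo --> 1%E ->
  0 < eta ->
  \forall n \near \oo, ((expR (- ((1 + eta) * f n)))%:E <= u n /\
                        u n <= (expR (- ((1 - eta) * f n)))%:E)%E.
Proof.
move=> foo /fine_cvgP[ufin /cvgrPdist_lt ucvg] eta0.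
have {ucvg} := ucvg _ eta0; have := ufin; have /cvgryPgt/(_ 0) := foo.
apply: filterS3 => n f0 /=.
case: (u n) => [r| |]/=.
(* A nonpositive [r] has logarithm [-oo], hence an infinite quotient, against eventual finiteness;
   the two infinite values are excluded likewise. *)
- case: ifPn => [r0|]; first by rewrite inver gt_eqF// gt0_mulye ?lte_fin ?invr_gt0.
  rewrite -ltNge => r0 _; rewrite inver gt_eqF//= ltr_norml => /andP[lo hi].
  have rE : r = expR (ln r) by rewrite lnK.
  rewrite !lee_fin rE !ler_expR.
  set t := - ln r / f n in lo hi *.
  have -> : ln r = - (t * f n) by rewrite /t divfK ?gt_eqF// opprK.
  by rewrite !lerN2 !ler_pM2r//; split; lra.
- by rewrite inver gt_eqF// gt0_mulNye ?lte_fin ?invr_gt0.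
- by rewrite inver gt_eqF// gt0_mulye ?lte_fin ?invr_gt0.
Qed.

(** Take the predecessor of the least index where [f] exceeds [c]; that index is nonzero because
    [f 0 <= c]. *)
Lemma exists_last_le (R : realType) (f : nat -> R) (c : R) :
  f @ \oo --> +oo -> f 0%N <= c -> exists m, f m <= c < f m.+1.
Proof.
move=> foo f0.
have exk : exists k, c < f k.
  by have /cvgryPgt/(_ c)[N _ NP] := foo; exists N; apply: NP => /=.
have [[|m] ck kmin] := ex_minnP exk; first by rewrite ltNge f0 in ck.
exists m; rewrite ck andbT leNgt; apply/negP => /kmin; by rewrite ltnn.
Qed.

(** * Comparison of the two scales and the limit *)

Section Lochs.
Context (R : realType) (lambda : probability (measurableTypeR R) R).
Context (P1 P2 : nat -> set (set R)) (f1 f2 : nat -> R).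
Hypothesis lambda01 : lambda `[0, 1]%classic = 1%E.
Hypotheses (partP1 : partition_sequence P1) (partP2 : partition_sequence P2).
Hypotheses (lE1 : lambda (endpoints P1) = 0%E) (lE2 : lambda (endpoints P2) = 0%E).
Hypotheses (wf1 : ae_weight lambda P1 f1) (wf2 : ae_weight lambda P2 f2).
Hypothesis sum_f1 : forall delta : R, 0 < delta ->
  (\sum_(1 <= n <oo) (expR (- delta * f1 n))%:E < +oo)%E.
Hypothesis f2_nondecr : nondecreasing_seq f2.
Hypothesis f2_incr : (fun n => f2 n.+1 - f2 n) =o_\oo f2.

(** If [m n < M], monotonicity gives [(1 - e) * f1 n < f2 M], which fails once [f1 n] is large. *)
Lemma scale_cvgy (e : R) (m : nat -> nat) : e < 1 ->
  (\forall n \near \oo, f2 (m n) <= (1 - e) * f1 n < f2 (m n).+1) ->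
  m @ \oo --> \oo.
Proof.
move=> e1 mf; have [f1oo _] := wf1; apply/cvgnyPge => M.
have /cvgryPge/(_ (f2 M / (1 - e))) := f1oo.
move: mf; apply: filterS2 => n /andP[_ ltm] leM.
rewrite leqNgt; apply/negP => mM.
have := f2_nondecr _ _ mM; rewrite leNgt => /negP; apply.
by apply: le_lt_trans ltm; rewrite -ler_pdivrMl 1?mulrC//; lra.
Qed.

(* With eta = e / 4 the ratio of the typical size of a P1-cell of index n to
   that of a P2-cell of index m n is at most exp (- (e / 2) f1 n), since
   (1 + eta) (1 - e) - (1 - eta) <= - e / 2. *)
Lemma ae_cell_subset_scale (e : R) : 0 < e < 1 ->
  exists m : nat -> nat,
    (\forall n \near \oo, f2 (m n) <= (1 - e) * f1 n < f2 (m n).+1) /\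
    {ae lambda, forall x, \forall n \near \oo,
      cell (P1 n) x `<=` cell (P2 (m n)) x}.
Proof.
move=> /andP[e0 e1].
have ae_filter := @ae_filter_ringOfSetsType _ _ _ lambda.
have [f1oo aew1] := wf1; have [f2oo aew2] := wf2.
(* The guard fails for only finitely many [n], where the index is arbitrary. *)
have exm n : exists k, f2 0%N <= (1 - e) * f1 n -> f2 k <= (1 - e) * f1 n < f2 k.+1.
  have [/(exists_last_le _ _ _ f2oo)[k kP]|nle] := pselect (f2 0%N <= (1 - e) * f1 n).
    by exists k.
  by exists 0%N => /nle.
have [m mP] := choice exm.
have mf : \forall n \near \oo, f2 (m n) <= (1 - e) * f1 n < f2 (m n).+1.
  have /cvgryPge/(_ (f2 0%N / (1 - e))) := f1oo.
  apply: filterS => n fn; apply: mP.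
  by rewrite -ler_pdivrMl 1?mulrC//; lra.
have m_oo := scale_cvgy _ _ e1 mf.
exists m; split => //.
pose eta := e / 4.
have f1pos : \forall n \near \oo, 0 <= f1 n by have /cvgryPge := f1oo; apply.
have [N _ NP] : \forall n \near \oo, (0 < n)%N /\ 0 <= f1 n /\
    f2 (m n) <= (1 - e) * f1 n.
  move: f1pos mf (nbhs_infty_gt 0).
  by apply: filterS3 => n ? /andP[? _] ?.
(* Vanishing below [N] lets the series be compared term by term: the exponent inequality is
   available only from [N] on. *)
pose alpha n := if (N <= n)%N then expR (- ((1 - eta) * f1 n)) else 0.
pose beta n := expR (- ((1 + eta) * f2 (m n))).
have sumab : (\sum_(n <oo) (2 * alpha n / beta n)%:E < +oo)%E.
  have alpha0 n : 0 <= alpha n by rewrite /alpha; case: ifP.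
  have ab0 n : 0 <= 2 * alpha n / beta n.
    by rewrite divr_ge0 ?mulr_ge0 ?expR_ge0.
  have abz n : ~~ (N <= n)%N -> 2 * alpha n / beta n = 0.
    by move=> /negbTE Nn; rewrite /alpha Nn mulr0 mul0r.
  (* The term of index 0 is split off because [sum_f1] starts at 1. *)
  rewrite nneseries_recl//; last by move=> k _; rewrite lee_fin.
  apply: lte_add_pinfty; first exact: ltry.
  apply: (@le_lt_trans _ _ (\sum_(1 <= n <oo)
      (2%:E * (expR (- (e / 2) * f1 n))%:E))%E); last first.
    rewrite nneseriesZl//.
    have := sum_f1 _ (divr_gt0 e0 (ltr0n R 2)).
    by apply: lte_mul_pinfty; rewrite ?lee_fin.
  apply: lee_nneseries => [k _ _|n _]; first by rewrite lee_fin.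
  rewrite -EFinM lee_fin.
  have [Nn|Nn] := boolP (N <= n)%N; last by rewrite abz// mulr_ge0 ?expR_ge0.
  have [_ [f1n0 f2n]] := NP _ Nn.
  rewrite /alpha Nn /beta expRN invrK -mulrA -expRD ler_pM2l// ler_expR.
  rewrite /eta; nra.
have alpha0 n : 0 <= alpha n by rewrite /alpha; case: ifP => // _; exact: expR_ge0.
have beta0 n : 0 < beta n by exact: expR_gt0.
have eta0 : 0 < eta by rewrite /eta; lra.
have := ae_eventually_cell_subset _ _ _ _ m _ _ lambda01 partP1 partP2 lE1 lE2
  alpha0 beta0 sumab.
move: aew1 aew2; apply: filterS3 => x w1 w2.
have := weight_expR_bounds _ _ _ _ f1oo w1 eta0.
have /m_oo := weight_expR_bounds _ _ _ _ f2oo w2 eta0.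
move=> w2m w1n; apply: filter_app; move: w1n w2m (nbhs_infty_ge N).
apply: filterS3 => n [_ le1] [ge2 _] Nn; apply => //.
by rewrite /alpha Nn.
Qed.

(** Deterministic part, at a fixed typical point: with [eta] equal to [1 / (k + 4)], the ratio is
    eventually squeezed between [(1 - eta) / (1 + eta)] and its inverse. *)
Lemma lochs_index_cvg (x : R) (m : nat -> nat -> nat) :
  (forall n, (0 < lambda (cell (P1 n) x))%E) ->
  (fun n => - lne (lambda (cell (P1 n) x)) / (f1 n)%:E)%E @ \oo --> 1%E ->
  (fun n => - lne (lambda (cell (P2 n) x)) / (f2 n)%:E)%E @ \oo --> 1%E ->
  (forall k, \forall n \near \oo,
     f2 (m k n) <= (1 - k.+4%:R^-1) * f1 n < f2 (m k n).+1) ->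
  (forall k, \forall n \near \oo, cell (P1 n) x `<=` cell (P2 (m k n)) x) ->
  exists L : nat -> nat,
    (forall n, lochs_index P1 P2 n x = (L n)%:R%:E) /\
    (fun n => f2 (L n) / f1 n) @ \oo --> (1 : R).
Proof.
move=> pos1 w1 w2 mP msub.
have [f1oo _] := wf1; have [f2oo _] := wf2.
have lesub n l : cell (P1 n) x `<=` cell (P2 l) x ->
    (lambda (cell (P1 n) x) <= lambda (cell (P2 l) x))%E.
  by move=> sub; apply: le_measure => //; rewrite inE; exact: measurable_cell.
(* The [P1]-cell has a fixed positive mass, while the [P2]-cells of [x] have masses at most
   [expR (- f2 l / 2)] eventually, tending to 0. *)
have bndS n : exists B, forall l, cell (P1 n) x `<=` cell (P2 l) x -> (l <= B)%N.
  have half0 : (0 : R) < 1 / 2 by lra.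
  have w2h := weight_expR_bounds _ _ _ _ f2oo w2 half0.
  set u := lambda (cell (P1 n) x).
  have fu : u \is a fin_num by apply: fin_num_measure; exact: measurable_cell.
  have u0 : 0 < fine u by rewrite fine_gt0// pos1 ltey_eq fu.
  have /cvgryPgt/(_ (- (2 * ln (fine u)))) f2big := f2oo.
  have [B _ BP] : \forall l \near \oo, ~ (cell (P1 n) x `<=` cell (P2 l) x).
    move: w2h f2big; apply: filterS2 => l [_ le2] f2l /lesub le1.
    have := le_trans le1 le2; rewrite -/u -(fineK fu) lee_fin.
    rewrite -[fine u]lnK// ler_expR; lra.
  by exists B => l Sl; rewrite leqNgt; apply/negP => /ltnW /BP.
have [L LP] := choice (fun n => let: ex_intro B BP := bndS n in
  lochs_index_bounded _ _ _ _ _ _ BP).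
exists L; split; first by move=> n; have [] := LP n.
apply/cvgrPdist_le => eps eps0.
(* The offset 4 forces [eta <= 1 / 4], whence [(1 + eta) / (1 - eta) <= 1 + 4 * eta <= 1 + eps]. *)
have [k _ /(_ k (leqnn k)) keps] : \forall k \near \oo, (k.+4%:R : R)^-1 <= eps / 4.
  near=> k; rewrite invf_ple ?posrE ?divr_gt0//.
  apply: (@le_trans _ _ k%:R); last by rewrite ler_nat -addn4 leq_addr.
  by near: k; exact: nbhs_infty_ger.
set eta := k.+4%:R^-1 in keps mP.
have eta0 : 0 < eta by rewrite invr_gt0.
have eta4 : eta <= 1 / 4 by rewrite /eta mul1r lef_pV2 ?posrE// ler_nat.
have w1b := weight_expR_bounds _ _ _ _ f1oo w1 eta0.
have [M _ MP] := weight_expR_bounds _ _ _ _ f2oo w2 eta0.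
have f2S : \forall l \near \oo, f2 l.+1 <= (1 + eta) * f2 l.
  have /eqoP/(_ _ eta0) := f2_incr.
  have /cvgryPge/(_ 0) := f2oo.
  apply: filterS2 => l f2l; rewrite (ger0_norm f2l) => /(le_trans (ler_norm _)).
  by lra.
have e1 : eta < 1 by lra.
have /(_ _ f2S) f2Sm := scale_cvgy _ _ e1 (mP k).
have /cvgryPgt/(_ 0) f1pos := f1oo.
have /cvgryPge/(_ (f2 M)) f1M := f1oo.
near=> n.
have f1n : 0 < f1 n by near: n.
have [L_index Lcell Lmax] := LP n.
(* Maximality gives [m k n <= L n]; [f2S] absorbs the passage from [(m k n).+1] to [m k n]. *)
have lower : (1 - eta) * f1 n <= (1 + eta) * f2 (L n).
  have /andP[_ ltm] : f2 (m k n) <= (1 - eta) * f1 n < f2 (m k n).+1.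
    by near: n; exact: mP.
  have mS : f2 (m k n).+1 <= (1 + eta) * f2 (m k n) by near: n.
  apply: le_trans (ltW ltm) (le_trans mS _).
  rewrite ler_pM2l; last lra.
  by apply: f2_nondecr; apply: Lmax; near: n; exact: msub.
have upper : (1 - eta) * f2 (L n) <= (1 + eta) * f1 n.
  have f2M : f2 M <= f1 n by near: n.
  (* The mass bound for [P2] holds only from index [M] on; a smaller [L n], or the default 0, is
     handled by [f2 M <= f1 n]. *)
  have small : f2 (L n) <= f2 M -> (1 - eta) * f2 (L n) <= (1 + eta) * f1 n by nra.
  have [LM|/ltnW ML] := leqP (L n) M; first by apply: small; exact: f2_nondecr.
  case: Lcell => [L0|/lesub le12]; first by apply: small; apply: f2_nondecr; rewrite L0.
  have [le1 _] : ((expR (- ((1 + eta) * f1 n)))%:E <= lambda (cell (P1 n) x) /\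
      lambda (cell (P1 n) x) <= (expR (- ((1 - eta) * f1 n)))%:E)%E by near: n.
  have [_ le2] := MP _ ML.
  have := le_trans le1 (le_trans le12 le2).
  by rewrite lee_fin ler_expR lerN2.
have yE : f2 (L n) = f2 (L n) / f1 n * f1 n by rewrite divfK ?gt_eqF.
move: (f2 (L n) / f1 n) yE => y yE; rewrite yE !mulrA !ler_pM2r// in lower upper.
rewrite ler_norml; apply/andP; split; nra.
Unshelve. all: by end_near. Qed.

End Lochs.

Theorem theorem6p8 (R : realType)
    (lambda : probability (measurableTypeR R) R)
    (lambda01 : lambda `[0, 1]%classic = 1%E)
    (P1 P2 : nat -> set (set R))
    (partP1 : partition_sequence P1) (partP2 : partition_sequence P2)
    (balP1 : log_balanced_ae lambda P1) (balP2 : log_balanced_ae lambda P2)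
    (f1 f2 : nat -> R)
    (wf1 : ae_weight lambda P1 f1) (wf2 : ae_weight lambda P2 f2)
    (sum_f1 : forall delta : R, 0 < delta ->
       (\sum_(1 <= n <oo) (expR (- delta * f1 n))%:E < +oo)%E)
    (f2_nondecr : nondecreasing_seq f2)
    (f2_incr : (fun n => f2 n.+1 - f2 n) =o_\oo f2) :
  {ae lambda, forall x : R,
    exists L : nat -> nat,
      (forall n, lochs_index P1 P2 n x = (L n)%:R%:E) /\
      (fun n => f2 (L n) / f1 n) @ \oo --> (1 : R)}.
Proof.
have ae_filter := @ae_filter_ringOfSetsType _ _ _ lambda.
have [lE1 _] := balP1; have [lE2 _] := balP2.
have k4 k : 0 < (k.+4%:R : R)^-1 < 1.
  by rewrite invr_gt0 ltr0n invf_lt1 ?ltr0n// ltr1n.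
(* Restricting [e] to the countable family [1 / (k + 4)] allows one null set to serve for all of
   them. *)
have [m mP] := choice (fun k => ae_cell_subset_scale _ _ _ _ _ _ lambda01 partP1 partP2
  lE1 lE2 wf1 wf2 sum_f1 f2_nondecr _ (k4 k)).
have ae_m := ae_foralln (fun k => (mP k).2).
have ae_pos := ae_cell_gt0 _ _ _ lambda01 partP1 lE1.
have [_ ae_w1] := wf1; have [_ ae_w2] := wf2.
have ae_w : {ae lambda, forall x : R,
    (fun n => - lne (lambda (cell (P1 n) x)) / (f1 n)%:E)%E @ \oo --> 1%E /\
    (fun n => - lne (lambda (cell (P2 n) x)) / (f2 n)%:E)%E @ \oo --> 1%E}.
  by move: ae_w1 ae_w2; apply: filterS2.
move: ae_m ae_pos ae_w; apply: filterS3 => x sub pos [w1 w2].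
apply: (lochs_index_cvg _ _ _ _ _ _ _ _ wf1 wf2 _ _ _ m) => // k.
exact: (mP k).1.
Qed.
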